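(* Let $h:\mathbb{N}\setminus\{0\}\to\mathbb{N}\setminus\{0\}$ be a function which has a finite-fold Diophantine representation. Then there exists a positive integer $m$ such that $h(n)<\tau(n)$ for every integer $n>m$.
   Context: $\mathbb{N}=\{0,1,2,\ldots\}$. A function $h:\mathbb{N}\setminus\{0\}\to\mathbb{N}\setminus\{0\}$ has a finite-fold Diophantine representation if there is a polynomial $W(x_1,x_2,y_1,\ldots,y_r)$ with integer coefficients such that for all positive integers $x_1,x_2$: $h(x_1)=x_2$ if and only if there exist $y_1,\ldots,y_r\in\mathbb{N}$ with $W(x_1,x_2,y_1,\ldots,y_r)=0$, and for all positive integers $x_1,x_2$ only finitely many tuples $(y_1,\ldots,y_r)\in\mathbb{N}^r$ satisfy $W(x_1,x_2,y_1,\ldots,y_r)=0$. For a positive integer $n$, $\tau(n)$ denotes the smallest positive integer $b$ such that for every system $T\subseteq\{x_i+1=x_k,\ x_i\cdot x_j=x_k:\ i,j,k\in\{1,\ldots,n\}\}$ having only finitely many solutions in positive integers $x_1,\ldots,x_n$, all these solutions belong to $[1,b]^n$. *)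

(* Defs.v *)
From HB Require Import structures.
From mathcomp Require Import all_boot all_order all_algebra.
From mathcomp Require Import boolp classical_sets cardinality.
From mathcomp Require Import mpoly.

Set Implicit Arguments.
Unset Strict Implicit.
Unset Printing Implicit Defensive.

Import GRing.Theory.

(* The variables of W are numbered x1 = 0, x2 = 1, y1 = 2, ..., yr = r.+1. *)
Definition eval_nat (r : nat) (W : {mpoly int[r.+2]}) (x1 x2 : nat)
    (y : r.-tuple nat) : int :=
  (W.@[fun i => (tnth [tuple of x1 :: x2 :: y] i)%:Z])%R.

(* A function from positive integers to positive integers is given by
   h : nat -> nat that is positive on positive arguments; h 0 is irrelevant. *)
Definition finite_fold_diophantine (h : nat -> nat) : Prop :=
  exists (r : nat) (W : {mpoly int[r.+2]}),
    (forall x1 x2 : nat, 0 < x1 -> 0 < x2 ->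
      (h x1 = x2 <-> exists y : r.-tuple nat, eval_nat W x1 x2 y = 0%R)) /\
    (forall x1 x2 : nat, 0 < x1 -> 0 < x2 ->
      finite_set [set y : r.-tuple nat | eval_nat W x1 x2 y = 0%R]%classic).

(* Succ i k is x_i + 1 = x_k and Mul i j k is x_i * x_j = x_k; indices range
   over {0, ..., n-1} instead of {1, ..., n}. *)
Inductive equation (n : nat) : Type :=
| Succ of 'I_n & 'I_n
| Mul of 'I_n & 'I_n & 'I_n.

Section EquationFinType.
Variable n : nat.

Definition equation_encode (e : equation n) :
    'I_n * 'I_n + 'I_n * 'I_n * 'I_n :=
  match e with Succ i k => inl (i, k) | Mul i j k => inr (i, j, k) end.

Definition equation_decode (c : 'I_n * 'I_n + 'I_n * 'I_n * 'I_n) :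
    equation n :=
  match c with inl (i, k) => Succ i k | inr (i, j, k) => Mul i j k end.

Lemma equation_encodeK : cancel equation_encode equation_decode.
Proof. by case. Qed.

HB.instance Definition _ := Finite.copy (equation n) (can_type equation_encodeK).

End EquationFinType.

Definition holds (n : nat) (x : n.-tuple nat) (e : equation n) : Prop :=
  match e with
  | Succ i k => tnth x i + 1 = tnth x k
  | Mul i j k => tnth x i * tnth x j = tnth x k
  end.

Definition solutions (n : nat) (T : {set equation n}) : set (n.-tuple nat) :=
  [set x | (forall i, 0 < tnth x i) /\
           (forall e, e \in T -> holds x e)]%classic.

Definition solution_bound (n b : nat) : Prop :=
  forall T : {set equation n}, finite_set (solutions T) ->
    forall x : n.-tuple nat, solutions T x -> forall i, 1 <= tnth x i <= b.

Lemma solution_bound_exists (n : nat) :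
  exists b, (0 < b) && `[< solution_bound n b >].
Proof.
have bT (T : {set equation n}) : exists b, finite_set (solutions T) ->
    forall x, solutions T x -> forall i, tnth x i <= b.
  have [/finite_seqP[s ->]|nfin] := pselect (finite_set (solutions T)).
    exists (\max_(x <- s) \max_i tnth x i) => _ x /= xs i.
    apply: leq_trans (leq_bigmax_seq _ xs isT).
    exact: (leq_bigmax (F := fun i => tnth x i)).
  by exists 0.
have /choice[b bP] := bT.
exists (\max_T b T).+1; apply/asboolP => T finT x Tx i.
have -> /= : 0 < tnth x i by case: Tx.
apply: leq_trans (bP T finT x Tx i) _.
by apply: leqW; apply: leq_bigmax.
Qed.

(* ex_minn is the least witness; positivity is part of the minimised predicate. *)
Definition tau (n : nat) : nat := ex_minn (solution_bound_exists n).

(* Main.v *)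
(* Julia Robinson's formula defines addition of positive integers from successor
   and multiplication, so the equation W = 0 becomes a system in a fixed number K
   of unknowns whose auxiliary unknowns are determined by x1, x2 and the y_i; one
   of the unknowns is x2 + 1. About n/2 further unknowns force x1 = n, which for
   n > 2 K + 10 fits in n unknowns altogether. The resulting system has finitely
   many solutions because W is finite-fold, and h n + 1 occurs in one of them. *)
Require Import Defs.
From mathcomp Require Import all_boot all_order all_algebra.
From mathcomp Require Import boolp classical_sets cardinality.
From mathcomp Require Import mpoly zify ring.

Set Implicit Arguments.
Unset Strict Implicit.
Unset Printing Implicit Defensive.

Import GRing.Theory.

(** * Systems over unknowns indexed by natural numbers, and their extensions *)

Definition nat_equation : eqType := (nat * nat + nat * nat * nat)%type.

Definition satisfies (v : nat -> nat) (e : nat_equation) : bool :=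
  match e with
  | inl (i, k) => v i + 1 == v k
  | inr (i, j, k) => v i * v j == v k
  end.

Definition indices_below (K : nat) (e : nat_equation) : bool :=
  match e with
  | inl (i, k) => (i < K) && (k < K)
  | inr (i, j, k) => [&& i < K, j < K & k < K]
  end.

Definition positive (v : nat -> nat) : Prop := forall i, 0 < v i.

Definition agree (k : nat) (v v' : nat -> nat) : Prop :=
  forall i, i < k -> v i = v' i.

Lemma indices_belowW k k' e : k <= k' -> indices_below k e -> indices_below k' e.
Proof. by case: e => [[i j]|[[i j] l]] /=; lia. Qed.

Lemma all_indices_belowW k k' L :
  k <= k' -> all (indices_below k) L -> all (indices_below k') L.
Proof. by move=> kk'; apply: sub_all => e; apply: indices_belowW. Qed.

Lemma all_satisfies_agree k v v' L : agree k v v' -> all (indices_below k) L ->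
  all (satisfies v) L -> all (satisfies v') L.
Proof.
move=> vv' /allP Lk /allP Lv; apply/allP => e eL.
move: (Lk e eL) (Lv e eL); case: e {eL} => [[i j]|[[i j] l]] /=.
  by move=> /andP[/vv' -> /vv' ->].
by move=> /and3P[/vv' -> /vv' -> /vv' ->].
Qed.

(* [L] introduces the variables of index in [k, k') and determines their values
   from those of index below k, without constraining the latter. *)
Record extension (k k' : nat) (L : seq nat_equation) : Prop := Extension {
  extension_le : k <= k';
  extension_below : all (indices_below k') L;
  extension_unique : forall v v', positive v -> positive v' ->
    all (satisfies v) L -> all (satisfies v') L -> agree k v v' -> agree k' v v';
  extension_exists : forall v, positive v ->
    exists v', [/\ positive v', agree k v v' & all (satisfies v') L] }.

Lemma extension_nil k : extension k k [::].
Proof. by split=> // v v_gt0; exists v. Qed.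

(** [L1] mentions only unknowns below [k2], so it stays satisfied when the second extension changes
    unknowns from [k2] on. *)
Lemma extension_cat k1 k2 k3 L1 L2 : extension k1 k2 L1 -> extension k2 k3 L2 ->
  extension k1 k3 (L1 ++ L2).
Proof.
move=> [le12 b1 u1 e1] [le23 b2 u2 e2]; split.
- exact: leq_trans le23.
- by rewrite all_cat (all_indices_belowW le23 b1).
- move=> v v' v0 v'0; rewrite !all_cat => /andP[s1 s2] /andP[s1' s2'] vv'.
  by apply: u2 => //; apply: u1.
- move=> v v0; have [w [w0 vw sw]] := e1 v v0; have [z [z0 wz sz]] := e2 w w0.
  exists z; split=> //.
    by move=> i ik; rewrite vw// wz//; lia.
  by rewrite all_cat sz (all_satisfies_agree wz b1 sw).
Qed.

(** Here [g v i] is the forced value of unknown [k + i]. Since [g] reads only unknowns below [k],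
    overwriting the others by these values does not change [g], which gives existence. *)
Lemma extension_of_values k d L (g : (nat -> nat) -> nat -> nat) :
  all (indices_below (k + d)) L ->
  (forall v i, positive v -> 0 < g v i) ->
  (forall v v', agree k v v' -> g v =1 g v') ->
  (forall v, positive v ->
     all (satisfies v) L <-> forall i, i < d -> v (k + i) = g v i) ->
  extension k (k + d) L.
Proof.
move=> Lk g0 gk LE; split=> //; first exact: leq_addr.
- move=> v v' v0 v'0 /(LE _ v0) vg /(LE _ v'0) v'g vv' i ikd.
  have [ik|ki] := ltnP i k; first exact: vv'.
  by rewrite -(subnKC ki) vg ?v'g ?(gk _ _ vv')//; lia.
- move=> v v0; pose w i := if i < k then v i else g v (i - k).
  have vw : agree k v w by move=> i ik; rewrite /w ik.
  have w0 : positive w by move=> i; rewrite /w; case: ifP => // _; apply: g0.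
  exists w; split=> //; apply/(LE _ w0) => i id.
  by rewrite -(gk _ _ vw) /w ltnNge leq_addr addKn.
Qed.

(** * One, successor, product and sum as extensions *)

Lemma extension_one k : extension k (k + 1) [:: inr (k, k, k)].
Proof.
apply: (@extension_of_values _ _ _ (fun _ _ => 1)) => //= [|v v0]; first lia.
have := v0 k; rewrite andbT; split=> [/eqP vk [|//] _|/(_ 0 isT)].
  by rewrite addn0; nia.
by rewrite addn0 => ->.
Qed.

Lemma extension_succ i k : i < k -> extension k (k + 1) [:: inl (i, k)].
Proof.
move=> ik; apply: (@extension_of_values _ _ _ (fun v _ => v i + 1)) => /=.
- lia.
- by move=> v _ _; rewrite addn1.
- by move=> v v' vv' _; rewrite vv'.
- move=> v v0; rewrite andbT; split=> [/eqP vk [|//] _|/(_ 0 isT)].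
    by rewrite addn0.
  by rewrite addn0 => ->.
Qed.

Lemma extension_mul i j k : i < k -> j < k ->
  extension k (k + 1) [:: inr (i, j, k)].
Proof.
move=> ik jk; apply: (@extension_of_values _ _ _ (fun v _ => v i * v j)) => /=.
- lia.
- by move=> v _ v0; rewrite muln_gt0 !v0.
- by move=> v v' vv' _; rewrite !vv'.
- move=> v v0; rewrite andbT; split=> [/eqP vk [|//] _|/(_ 0 isT)].
    by rewrite addn0.
  by rewrite addn0 => ->.
Qed.

(** After expansion the two sides differ only in [z * (x + y)] against [z * z], and a positive [z]
    cancels. *)
Lemma robinson_sum x y z : 0 < z ->
  ((x * z + 1) * (y * z + 1) == z * z * (x * y + 1) + 1) = (x + y == z).
Proof.
move=> z0.
have -> : (x * z + 1) * (y * z + 1) = z * z * (x * y) + z * (x + y) + 1 by ring.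
have -> : z * z * (x * y + 1) + 1 = z * z * (x * y) + z * z + 1 by ring.
by rewrite eqn_add2r eqn_add2l eqn_pmul2l.
Qed.

(** Unknown [k] is the sum. No single equation defines it: the last equation closes onto [k + 5],
    already the left side of Robinson's identity, instead of opening a new unknown. *)
Definition addition_system (i j k : nat) : seq nat_equation :=
  [:: inr (i, k, k + 1); inl (k + 1, k + 2); inr (j, k, k + 3);
      inl (k + 3, k + 4); inr (k + 2, k + 4, k + 5); inr (k, k, k + 6);
      inr (i, j, k + 7); inl (k + 7, k + 8); inr (k + 6, k + 8, k + 9);
      inl (k + 9, k + 5)].

Lemma extension_add i j k : i < k -> j < k ->
  extension k (k + 10) (addition_system i j k).
Proof.
move=> ik jk.
(* The list follows the offsets 0 to 9 of [addition_system]; the default 1 below keeps the values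
   positive past its end. *)
pose values x y := let z := x + y in
  [:: z; x * z; x * z + 1; y * z; y * z + 1; (x * z + 1) * (y * z + 1);
      z * z; x * y; x * y + 1; z * z * (x * y + 1)].
apply: (@extension_of_values _ _ _ (fun v => nth 1 (values (v i) (v j)))) => /=.
- lia.
- move=> v l v0; have := v0 i; have := v0 j; move: (v i) (v j) => x y y0 x0.
  by do 10?[case: l => [|l] /=; first by rewrite ?(muln_gt0, addn_gt0) ?x0 ?y0];
    case: l.
- by move=> v v' vv'; rewrite !vv'.
- move=> v v0; split.
    move=> /and5P[/eqP e1 /eqP e2 /eqP e3 /eqP e4 /and5P[/eqP e5 /eqP e6 /eqP e7
      /eqP e8 /and3P[/eqP e9 /eqP e10 _]]].
    have zE : v i + v j = v k.
      apply/eqP; rewrite -robinson_sum//; apply/eqP.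
      by rewrite e1 e2 e3 e4 e5 e6 e7 e8 e9 e10.
    do 10?[case=> [_|] /=; first by rewrite ?addn0 ?zE; congruence].
    by [].
  move=> vE.
  rewrite (vE 1)// (vE 2)// (vE 3)// (vE 4)// (vE 5)// (vE 6)// (vE 7)// (vE 8)//.
  rewrite (vE 9)// -(addn0 k) (vE 0)//= !eqxx /= andbT eq_sym robinson_sum//.
  by rewrite addn_gt0 v0.
Qed.

(** * From definable terms to the equation [W = 0] *)

(** Any starting index [k] from [k0] on is allowed, so the auxiliary unknowns of one subterm can be
    placed after those of another. *)
Definition definable (k0 : nat) (f : (nat -> nat) -> nat) : Prop :=
  forall k, k0 <= k -> exists k' L o, [/\ extension k k' L, o < k' &
    forall v, positive v -> all (satisfies v) L -> v o = f v].

Lemma definable_var k0 i : i < k0 -> definable k0 (fun v => v i).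
Proof.
move=> ik0 k k0k; exists k, [::], i; split=> //; first exact: extension_nil.
exact: leq_trans k0k.
Qed.

Lemma definable_one k0 : definable k0 (fun=> 1).
Proof.
move=> k _; exists (k + 1), [:: inr (k, k, k)], k.
split=> [||v v0 /=]; [exact: extension_one|lia|].
by rewrite andbT => /eqP; have := v0 k; nia.
Qed.

Lemma definable_op2 k0 (op : nat -> nat -> nat) f g :
  (forall i j k, i < k -> j < k -> exists k' L o, [/\ extension k k' L, o < k' &
    forall v, positive v -> all (satisfies v) L -> v o = op (v i) (v j)]) ->
  definable k0 f -> definable k0 g -> definable k0 (fun v => op (f v) (g v)).
Proof.
move=> op_def f_def g_def k k0k.
have [k1 [L1 [o1 [x1 o1k f1]]]] := f_def k k0k.
have [k2 [L2 [o2 [x2 o2k g2]]]] := g_def k1 (leq_trans k0k (extension_le x1)).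
have [k3 [L3 [o3 [x3 o3k h3]]]] :=
  op_def o1 o2 k2 (leq_trans o1k (extension_le x2)) o2k.
exists k3, (L1 ++ L2 ++ L3), o3; split=> //.
  by apply: extension_cat x1 _; apply: extension_cat x3.
move=> v v0; rewrite !all_cat => /and3P[s1 s2 s3].
by rewrite h3// f1// g2.
Qed.

Lemma definable_mul k0 f g : definable k0 f -> definable k0 g ->
  definable k0 (fun v => f v * g v).
Proof.
apply: definable_op2 => i j k ik jk.
exists (k + 1), [:: inr (i, j, k)], k.
split=> [||v v0 /=]; [exact: extension_mul|lia|].
by rewrite andbT => /eqP.
Qed.

Lemma definable_add k0 f g : definable k0 f -> definable k0 g ->
  definable k0 (fun v => f v + g v).
Proof.
apply: definable_op2 => i j k ik jk.
exists (k + 10), (addition_system i j k), k.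
split=> [||v v0 /=]; [exact: extension_add|lia|].
move=> /and5P[/eqP e1 /eqP e2 /eqP e3 /eqP e4 /and5P[/eqP e5 /eqP e6 /eqP e7
  /eqP e8 /and3P[/eqP e9 /eqP e10 _]]].
apply/esym/eqP; rewrite -robinson_sum//; apply/eqP.
by rewrite e1 e2 e3 e4 e5 e6 e7 e8 e9 e10.
Qed.

Lemma definable_const k0 n : definable k0 (fun=> n.+1).
Proof.
elim: n => [|n IHn]; first exact: definable_one.
exact: (definable_add (@definable_one k0) IHn).
Qed.

(* Only positive values are available, so an integer is encoded as a difference
   of two positive ones. *)
Definition representable (k0 : nat) (F : (nat -> nat) -> int) : Prop :=
  exists P Q, [/\ definable k0 P, definable k0 Q &
    forall v, positive v -> F v = ((P v)%:Z - (Q v)%:Z)%R].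

Lemma representable_const k0 (c : int) : representable k0 (fun=> c).
Proof.
case: c => n.
  exists (fun=> n.+1), (fun=> 1); split=> [||v _]; try exact: definable_const.
  by lia.
exists (fun=> 1), (fun=> n.+2); split=> [||v _]; try exact: definable_const.
by lia.
Qed.

(** The shift by [b] serves the y_i, which may be 0 and are stored as y_i + 1; x1 and x2 take
    [b = false]. *)
Lemma representable_var k0 i (b : bool) : i < k0 ->
  representable k0 (fun v => (v i)%:Z - b%:Z)%R.
Proof.
move=> ik0; case: b.
  exists (fun v => v i), (fun=> 1).
  by split=> //; [exact: definable_var|exact: definable_one].
exists (fun v => v i + 1), (fun=> 1).
split=> [||v _]; last by lia.
  exact: definable_add (definable_var ik0) (@definable_one k0).
exact: definable_one.
Qed.

Lemma representable_add k0 F G : representable k0 F -> representable k0 G ->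
  representable k0 (fun v => F v + G v)%R.
Proof.
move=> [P [Q [dP dQ FE]]] [P' [Q' [dP' dQ' GE]]].
exists (fun v => P v + P' v), (fun v => Q v + Q' v).
split=> [||v v0]; try exact: definable_add.
by rewrite FE// GE//; lia.
Qed.

Lemma representable_mul k0 F G : representable k0 F -> representable k0 G ->
  representable k0 (fun v => F v * G v)%R.
Proof.
move=> [P [Q [dP dQ FE]]] [P' [Q' [dP' dQ' GE]]].
exists (fun v => P v * P' v + Q v * Q' v), (fun v => P v * Q' v + Q v * P' v).
split=> [||v v0]; try by apply: definable_add; apply: definable_mul.
by rewrite FE// GE// !PoszD !PoszM; ring.
Qed.

Lemma representable_sum k0 (I : Type) (s : seq I) F :
  (forall i, representable k0 (F i)) ->
  representable k0 (fun v => \sum_(i <- s) F i v)%R.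
Proof.
move=> rF; elim: s => [|i s IHs].
  by under eq_fun do rewrite big_nil; apply: representable_const.
by under eq_fun do rewrite big_cons; apply: representable_add.
Qed.

Lemma representable_prod k0 (I : Type) (s : seq I) F :
  (forall i, representable k0 (F i)) ->
  representable k0 (fun v => \prod_(i <- s) F i v)%R.
Proof.
move=> rF; elim: s => [|i s IHs].
  by under eq_fun do rewrite big_nil; apply: representable_const.
by under eq_fun do rewrite big_cons; apply: representable_mul.
Qed.

Lemma representable_exp k0 F n : representable k0 F ->
  representable k0 (fun v => F v ^+ n)%R.
Proof.
move=> rF; elim: n => [|n IHn].
  by under eq_fun do rewrite expr0; apply: representable_const.
by under eq_fun do rewrite exprS; apply: representable_mul.
Qed.

Lemma representable_meval k0 n (W : {mpoly int[n]}) F :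
  (forall i, representable k0 (F i)) ->
  representable k0 (fun v => W.@[fun i => F i v])%R.
Proof.
move=> rF; under eq_fun do rewrite mevalE.
apply: representable_sum => m; apply: representable_mul.
  exact: representable_const.
by apply: representable_prod => i; apply: representable_exp.
Qed.

Lemma representable_eval_nat r (W : {mpoly int[r.+2]}) :
  representable r.+2
    (fun v => eval_nat W (v 0) (v 1) [tuple (v i.+2).-1 | i < r]).
Proof.
have [P [Q [dP dQ PQ]]] := representable_meval W
  (fun i : 'I_r.+2 => representable_var (1 < i) (ltn_ord i)).
exists P, Q; split=> // v v0; rewrite -PQ// /eval_nat.
apply: meval_eq => i.
case: i => [[|[|i]] ir] /=; rewrite (tnth_nth 0) /=.
- by rewrite subr0.
- by rewrite subr0.
- rewrite (nth_map (Ordinal (ir : i < r))) ?size_enum_ord//.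
  by rewrite nth_enum_ord//; have := v0 i.+2; lia.
Qed.

(* Variables 0, 1 and i.+2 stand for x1, x2 and y_i + 1. *)
Lemma diophantine_system r (W : {mpoly int[r.+2]}) :
  exists K L C o, [/\ extension r.+2 K L, indices_below K C, o < K &
    forall v, positive v -> all (satisfies v) L ->
      v o = v 1 + 1 /\
      (satisfies v C <->
       eval_nat W (v 0) (v 1) [tuple (v i.+2).-1 | i < r] = 0%R)].
Proof.
have [P [Q [dP dQ PQ]]] := representable_eval_nat W.
have [k1 [L1 [p [x1 pk1 pP]]]] := dP r.+2 (leqnn _).
have [k2 [L2 [q [x2 qk2 qQ]]]] := dQ k1 (extension_le x1).
have x3 := extension_one k2.
have k1k2 := extension_le x2.
have rk1 := extension_le x1.
have lt1k : 1 < k2 + 1 by lia.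
have x4 := extension_succ lt1k.
(* Unknown [k2] is 1, so [C] says [P * 1 = Q], that is [W = 0]. It is kept out of [L], which must be
   solvable for all x1, x2, y. Unknown [k2 + 1] is x2 + 1. *)
exists (k2 + 1 + 1), (L1 ++ L2 ++ [:: inr (k2, k2, k2)] ++ [:: inl (1, k2 + 1)]),
  (inr (p, k2, q)), (k2 + 1).
split; [|rewrite /=; lia|lia|].
  by do 2![apply: extension_cat; first by eassumption]; exact: extension_cat x4.
move=> v v0; rewrite !all_cat => /and4P[s1 s2 /= /andP[/eqP s3 _]].
move=> /andP[/eqP s4 _]; split=> //.
have v1 : v k2 = 1 by have := v0 k2; nia.
rewrite PQ// pP// qQ// v1 muln1.
by split=> [/eqP ->|/eqP]; [rewrite subrr|rewrite subr_eq0 => /eqP[->]].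
Qed.

(** * Forcing x1 = n *)

(** Unknowns [K] and [K.+1] hold the largest even number up to [n] and its successor; the parity of
    [n] decides which of them equals x1. *)
Definition chain_value (K n j : nat) : nat :=
  if j == K then n./2.*2 else if j == K.+1 then n./2.*2.+1 else j - K.+1.

(* Variables K + 2, ..., n - 1 take the values 1, ..., n - K - 2, so n./2 is
   among them once n is large, and n is reached by doubling it. *)
Definition chain_system (K n : nat) : seq nat_equation :=
  [:: inr (K.+2, K.+2, K.+2); inr (K.+3, K.+1 + n./2, K); inl (K, K.+1);
      inr (K.+2, K + odd n, 0)] ++
  [seq inl (j, j.+1) | j <- iota K.+2 (n - K.+3)].

(** The critical index is [K.+1 + n./2], below [n] because [K.+1] is less than half of [n]. *)
Lemma chain_system_below K n : 2 * K + 10 < n ->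
  all (indices_below n) (chain_system K n).
Proof.
move=> Kn; rewrite all_cat; apply/andP; split=> /=; first by lia.
by apply/allP => _ /mapP[j + ->] /=; rewrite mem_iota; lia.
Qed.

Lemma chain_systemP K n v : 2 * K + 10 < n -> positive v ->
  all (satisfies v) (chain_system K n) <->
  v 0 = n /\ forall j, K <= j < n -> v j = chain_value K n j.
Proof.
move=> Kn v0; rewrite all_cat; split.
  move=> /andP[/and5P[/eqP e1 /eqP e2 /eqP e3 /eqP e4 _] /allP es].
  have v1 : v K.+2 = 1 by have := v0 K.+2; nia.
  (* The successor equations count upwards from the 1 at [K.+2]. *)
  have vE d : K.+2 + d < n -> v (K.+2 + d) = d.+1.
    elim: d => [|d IHd] dn; first by rewrite addn0.
    have /es/eqP : inl (K.+2 + d, (K.+2 + d).+1) \in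
        [seq (inl (j, j.+1) : nat_equation) | j <- iota K.+2 (n - K.+3)].
      by apply/mapP; exists (K.+2 + d) => //; rewrite mem_iota; lia.
    by rewrite -addnS IHd; lia.
  have v2 : v K.+3 = 2 by rewrite -(vE 1) ?addn1//; lia.
  have vh : v (K.+1 + n./2) = n./2.
    have -> : K.+1 + n./2 = K.+2 + n./2.-1 by lia.
    by rewrite vE; lia.
  have vK : v K = n./2.*2 by rewrite -e2 v2 vh; lia.
  split.
    rewrite -e4 v1 mul1n -[RHS]odd_double_half.
    by case: (odd n) => /=; rewrite ?addn0 ?addn1 -?e3 vK; lia.
  move=> j /andP[Kj jn]; rewrite /chain_value.
  case: eqP => [->|jK] //; case: eqP => [->|jK1]; first by rewrite -e3; lia.
  have -> : j = K.+2 + (j - K.+2) by lia.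
  by rewrite vE; lia.
move=> [v0n vE].
have vK : v K = n./2.*2 by rewrite vE /chain_value ?eqxx//; lia.
have vK1 : v K.+1 = n./2.*2.+1.
  by rewrite vE /chain_value ?eqxx ?gtn_eqF//; lia.
have vj j : K.+1 < j < n -> v j = j - K.+1.
  by move=> Kjn; rewrite vE /chain_value ?gtn_eqF//; lia.
apply/andP; split; last first.
  by apply/allP => _ /mapP[j + ->] /=; rewrite mem_iota => jn; rewrite !vj; lia.
apply/and5P; split=> //=.
- by rewrite !vj; lia.
- by rewrite vK !vj; lia.
- by rewrite vK vK1 addn1.
- have := odd_double_half n; rewrite v0n vj; last by lia.
  by case: (odd n) => /= nE; rewrite ?addn0 ?addn1 ?vK ?vK1; lia.
Qed.

(** * Transfer to subsets of [equation n] *)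

Definition to_nat_equation n (e : equation n) : nat_equation :=
  match e with
  | Succ i k => inl (nat_of_ord i, nat_of_ord k)
  | Mul i j k => inr (nat_of_ord i, nat_of_ord j, nat_of_ord k)
  end.

Lemma satisfies_holds n (x : n.-tuple nat) e :
  satisfies (nth 1 x) (to_nat_equation e) <-> holds x e.
Proof.
by case: e => [i k|i j k] /=; rewrite !(tnth_nth 1); split=> /eqP.
Qed.

Lemma to_nat_equation_onto n e : indices_below n e ->
  exists e' : equation n, to_nat_equation e' = e.
Proof.
case: e => [[i k] /= /andP[lt_i lt_k]|[[i j] k] /= /and3P[lt_i lt_j lt_k]].
  by exists (Succ (Ordinal lt_i) (Ordinal lt_k)).
by exists (Mul (Ordinal lt_i) (Ordinal lt_j) (Ordinal lt_k)).
Qed.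

Definition system n (L : seq nat_equation) : {set equation n} :=
  [set e | to_nat_equation e \in L]%SET.

(** Padding with the default 1 makes [nth 1 x] positive everywhere, and the index bound ensures that
    no equation of [L] is lost in [system n L]. *)
Lemma solutions_systemP n L (x : n.-tuple nat) : all (indices_below n) L ->
  solutions (system n L) x <->
  positive (nth 1 x) /\ all (satisfies (nth 1 x)) L.
Proof.
move=> /allP Ln; split=> [[x0 xL]|[x0 /allP xL]]; split.
- move=> i; have [ni|lt_i] := leqP n i; first by rewrite nth_default// size_tuple.
  by have := x0 (Ordinal lt_i); rewrite (tnth_nth 1).
- apply/allP => e eL; have [e' e'E] := to_nat_equation_onto (Ln e eL).
  by rewrite -e'E; apply/satisfies_holds/xL; rewrite inE e'E.
- by move=> i; rewrite (tnth_nth 1).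
- by move=> e; rewrite inE => /xL/satisfies_holds.
Qed.

Lemma leq_tau n T (x : n.-tuple nat) i :
  finite_set (solutions T) -> solutions T x -> tnth x i <= tau n.
Proof.
move=> finT xT; rewrite /tau; case: ex_minnP => b /andP[_ /asboolP bn] _.
by have /andP[] := bn T finT x xT i.
Qed.

(** * Comparison of [h] with [tau] *)

Theorem theorem6 (h : nat -> nat) (h_pos : forall n : nat, 0 < n -> 0 < h n)
    (h_ff : finite_fold_diophantine h) :
  exists m : nat, 0 < m /\ forall n : nat, m < n -> h n < tau n.
Proof.
have [r [W [hW finW]]] := h_ff.
have [K [L [C [o [xL CK oK LP]]]]] := diophantine_system W.
(* [K] comes from [W] alone, so this bound does not depend on [n]. *)
exists (2 * K + 10); split=> [|n Kn]; first by rewrite addnS.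
have n0 : 0 < n by lia.
have rK := extension_le xL.
pose S := C :: L ++ chain_system K n.
have SE v : all (satisfies v) S =
    [&& satisfies v C, all (satisfies v) L & all (satisfies v) (chain_system K n)].
  by rewrite /S /= all_cat.
have Sn : all (indices_below n) S.
  rewrite /S /= all_cat chain_system_below// andbT.
  rewrite (all_indices_belowW _ (extension_below xL)) ?andbT; last by lia.
  by apply: indices_belowW CK; lia.
pose ys (v : nat -> nat) : r.-tuple nat := [tuple (v i.+2).-1 | i < r].
have ysE v (i : 'I_r) : tnth (ys v) i = (v i.+2).-1 by rewrite tnth_mktuple.
(* The chain forces x1 = n; then [C] gives a zero of [W] at (n, x2), whence x2 = h n. *)
have solP (x : n.-tuple nat) : solutions (system n S) x ->
    [/\ positive (nth 1 x) /\ all (satisfies (nth 1 x)) L,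
      nth 1 x 0 = n, nth 1 x 1 = h n,
      forall j, K <= j < n -> nth 1 x j = chain_value K n j
      & eval_nat W n (h n) (ys (nth 1 x)) = 0%R].
  move=> /(solutions_systemP _ Sn)[v0]; rewrite SE => /and3P[vC vL].
  move=> /(chain_systemP Kn v0)[vn vE]; have [_ [/(_ vC) + _]] := LP _ v0 vL.
  rewrite -/(ys _) vn => W0.
  have h1 : h n = nth 1 x 1 by apply/hW => //; exists (ys (nth 1 x)).
  by rewrite h1.
have fin_sol : finite_set (solutions (system n S)).
  pose A := solutions (system n S).
  (* A solution is determined by its y part: x1 and x2 are fixed, unknowns up to [K] follow by
     uniqueness of the extension, and the rest are chain values. *)
  have Y_inj : {in A &, injective (fun x : n.-tuple nat => ys (nth 1 x))}.
    move=> x x' /set_mem/solP[[v0 vL] vn v1 vE _] /set_mem/solP[[w0 wL] wn w1 wE _] xx'.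
    have agr : agree r.+2 (nth 1 x) (nth 1 x').
      move=> [|[|i]] ir; [by rewrite vn|by rewrite v1|].
      have := congr1 (fun y => tnth y (Ordinal (ir : i < r))) xx'.
      by rewrite !ysE /=; have := v0 i.+2; have := w0 i.+2; lia.
    have agK := extension_unique xL v0 w0 vL wL agr.
    apply: (@eq_from_tnth _ _ x x') => i; rewrite !(tnth_nth 1).
    have [iK|Ki] := ltnP i K; first exact: agK.
    by rewrite vE ?wE// Ki /=.
  rewrite -/A -(eq_finite_set (inj_card_eq Y_inj)).
  apply: sub_finite_set (finW n (h n) n0 (h_pos n n0)).
  by move=> _ [x /solP[_ _ _ _ yW] <-].
have [y yW] : exists y : r.-tuple nat, eval_nat W n (h n) y = 0%R.
  by apply/hW => //; apply: h_pos.
(* A zero [y] of [W] at (n, h n) is stored with each entry raised by 1. *)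
pose u i := nth 1 [:: n, h n & [seq j.+1 | j <- y]] i.
have u0 : positive u.
  move=> [|[|i]]; rewrite /u //=; first exact: h_pos.
  have [ir|ri] := ltnP i r; last by rewrite nth_default// size_map size_tuple.
  by rewrite (nth_map 0) ?size_tuple.
have [w [w0 uw wL]] := extension_exists xL u0.
(* The extension and the chain share only unknown 0, so their values can be glued at [K]; the value
   1 from [n] on keeps [v] positive. *)
pose v i := if i < K then w i else if i < n then chain_value K n i else 1.
have wv : agree K w v by move=> i iK; rewrite /v iK.
have v0 : positive v.
  move=> i; rewrite /v; case: (ltnP i K) => [_|Ki]; first exact: w0.
  case: (ltnP i n) => // _; rewrite /chain_value; do 2?[case: eqP => ?]; lia.
have uv : agree r.+2 u v by move=> i ir; rewrite uw// wv//; lia.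
have vn : v 0 = n by rewrite -uv.
have vh : v 1 = h n by rewrite -uv.
have vL := all_satisfies_agree wv (extension_below xL) wL.
have ysv : ys v = y.
  apply: eq_from_tnth => i; rewrite ysE -uv ?ltnS// /u /=.
  by rewrite (nth_map 0) ?size_tuple// (tnth_nth 0).
have [vo vC] := LP v v0 vL.
have vS : all (satisfies v) S.
  rewrite SE vL /=; apply/andP; split.
    by apply/vC; rewrite vn vh -/(ys v) ysv.
  apply/(chain_systemP Kn v0); split=> // j /andP[Kj jn].
  by rewrite /v ltnNge Kj jn.
pose x : n.-tuple nat := [tuple v i | i < n].
have xv : agree n v (nth 1 x).
  by move=> i lt_i; rewrite (_ : i = Ordinal lt_i)// -tnth_nth tnth_mktuple.
have xsol : solutions (system n S) x.
  apply/(solutions_systemP _ Sn); split; last exact: (all_satisfies_agree xv Sn).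
  move=> i; have [ni|lt_i] := leqP n i; first by rewrite nth_default// size_tuple.
  by rewrite -xv.
have on : o < n by lia.
(* Entry [o] of this solution is h n + 1, which makes the inequality strict. *)
have := leq_tau (Ordinal on) fin_sol xsol.
by rewrite tnth_mktuple /= vo vh addn1.
Qed.
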